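(* Let $m\in\mathbb{Z}$ and for $n\ge 0$ let $$\Phi_n(x,s,m,q)=\sum_{k=0}^{\lfloor (n-1)/2\rfloor} q^{\binom{k+1}{2}+m\binom{k}{2}}\begin{bmatrix} n-1-k\\ k\end{bmatrix}s^k x^{n-1-2k}.$$ Then for all $n\ge 2$ $$\Phi_n(x,s,m,q)=x\,\Phi_{n-1}(x,qs,m,q)+qs\,\Phi_{n-2}(x,q^{m+1}s,m,q),$$ with initial values $\Phi_0(x,s,m,q)=0$ and $\Phi_1(x,s,m,q)=1$.
   Context: Here $q$, $x$, $s$ are indeterminates. Write $[n]=\frac{1-q^n}{1-q}$, $[n]!=[1][2]\cdots[n]$, and $\begin{bmatrix} n\\ k\end{bmatrix}=\frac{[n]!}{[k]![n-k]!}$ for $0\le k\le n$ (the $q$-binomial coefficient). Empty sums are $0$. *)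

(* Defs.v *)
From mathcomp Require Import all_boot all_order all_algebra.
From mathcomp Require Import mpoly.

Set Implicit Arguments.
Unset Strict Implicit.
Unset Printing Implicit Defensive.

Import GRing.Theory.

Local Open Scope ring_scope.

Section Phi.
Variable K : fieldType.

Definition qnum (q : K) (n : nat) : K := (1 - q ^+ n) / (1 - q).

Definition qfact (q : K) (n : nat) : K := \prod_(1 <= i < n.+1) qnum q i.

(* Only meaningful for k <= n, since n - k is truncated. *)
Definition qbinom (q : K) (n k : nat) : K :=
  qfact q n / (qfact q k * qfact q (n - k)).

(* The number of k with 0 <= k <= floor ((n - 1) / 2) is floor ((n + 1) / 2),
   also for n = 0, where floor (-1 / 2) = -1 makes the sum empty. On this range
   2k <= n - 1 and k <= n - 1 - k, so no natural subtraction is truncated.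
   The exponent of q is an integer, negative for instance when m is very
   negative and 2 <= k. *)
Definition Phi (n : nat) (x s : K) (m : int) (q : K) : K :=
  \sum_(0 <= k < (n.+1)./2)
     q ^ ('C(k.+1, 2)%:Z + m * 'C(k, 2)%:Z) * qbinom q (n - 1 - k) k
       * s ^+ k * x ^+ (n - 1 - 2 * k).

End Phi.

(* The field F(q, x, s) of rational functions in three indeterminates. It
   contains the negative powers of q and the quotients of q-factorials, and
   Phi n x (q * s) m q is there the result of substituting q * s for s. *)
Definition ratfun (F : fieldType) : fieldType := {fraction {mpoly F[3]}}.

Definition indet (F : fieldType) (i : 'I_3) : ratfun F :=
  tofrac ('X_i : {mpoly F[3]}).

Definition q_ (F : fieldType) : ratfun F := indet F 0.
Definition x_ (F : fieldType) : ratfun F := indet F 1.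
Definition s_ (F : fieldType) : ratfun F := indet F 2.

(* Main.v *)
Require Import Defs.
From mathcomp Require Import all_boot all_order all_algebra.
From mathcomp Require Import mpoly.
From mathcomp Require Import zify ring.

Set Implicit Arguments.
Unset Strict Implicit.
Unset Printing Implicit Defensive.

Import GRing.Theory.

Local Open Scope ring_scope.

(** Compare the coefficients of [s ^ k * x ^ (n - 1 - 2 * k)] on both sides.
    Substituting [q * s] for [s] multiplies the k-th term of [Phi] by [q ^ k],
    and in the last summand the shift from [k] to [k - 1] together with the
    factor [q * (q ^ (m + 1)) ^ (k - 1)] restores exactly the power of [q] of
    the left-hand side ([qexponent_shift]).  After cancelling that power, what
    remains is the q-Pascal rule
    [qbinom q (n - 1 - k) k
       = q ^ k * qbinom q (n - 2 - k) k + qbinom q (n - 2 - k) (k - 1)]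
    ([qbinom_pascal]).  It needs every [qnum q n] with [0 < n] to be nonzero,
    that is, [q] not to be a root of unity; an indeterminate is not one
    ([q_expn_neq1]).

    The three sums have different lengths.  They are brought to a common one by
    the filter [k.*2 < n] ([Phi_widen]), so that the term of [Phi (n - 1)] that
    is absent when [n] is odd becomes a zero term, matched by the boundary case
    of the q-Pascal rule. *)

Section QRecurrence.
Variables (K : fieldType) (q : K).
Hypothesis q_expn_neq1 : forall n, (0 < n)%N -> q ^+ n != 1.

Lemma subr1q_neq0 : 1 - q != 0.
Proof. by rewrite subr_eq0 eq_sym -(expr1 q) q_expn_neq1. Qed.

Lemma qnum_neq0 n : (0 < n)%N -> qnum q n != 0.
Proof.
move=> n_gt0; rewrite /qnum mulf_neq0 ?invr_eq0 ?subr1q_neq0 //.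
by rewrite subr_eq0 eq_sym q_expn_neq1.
Qed.

Lemma qfactS n : qfact q n.+1 = qfact q n * qnum q n.+1.
Proof. by rewrite /qfact big_nat_recr. Qed.

Lemma qfact0 : qfact q 0 = 1.
Proof. by rewrite /qfact big_geq. Qed.

Lemma qfact_neq0 n : qfact q n != 0.
Proof.
elim: n => [|n IHn]; first by rewrite qfact0 oner_neq0.
by rewrite qfactS mulf_neq0 ?qnum_neq0.
Qed.

Lemma qbinom0 n : qbinom q n 0 = 1.
Proof. by rewrite /qbinom subn0 qfact0 mul1r divff ?qfact_neq0. Qed.

Lemma qbinomnn n : qbinom q n n = 1.
Proof. by rewrite /qbinom subnn qfact0 mulr1 divff ?qfact_neq0. Qed.

Lemma qnumD a b : qnum q (a + b) = q ^+ a * qnum q b + qnum q a.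
Proof. by rewrite /qnum exprD; field; rewrite subr1q_neq0. Qed.

(** Over the common denominator this is [qnumD] for
    [n.+1 = k.+1 + (n - k)].  The conditional is there because
    [qbinom q n n.+1] is not zero: its truncated difference makes it
    [(qnum q n.+1)^-1]. *)
Lemma qbinom_pascal n k : (k <= n)%N ->
  qbinom q n.+1 k.+1 =
    (if (k < n)%N then q ^+ k.+1 * qbinom q n k.+1 else 0) + qbinom q n k.
Proof.
rewrite leq_eqVlt => /orP[/eqP->|lt_kn]; first by rewrite ltnn !qbinomnn add0r.
rewrite lt_kn /qbinom subSS.
have -> : (n - k = (n - k.+1).+1)%N by lia.
rewrite !qfactS.
have -> : qnum q n.+1 = q ^+ k.+1 * qnum q (n - k.+1).+1 + qnum q k.+1.
  by rewrite -qnumD; congr (qnum q _); lia.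
have k_neq0 := qnum_neq0 (ltn0Sn k).
have d_neq0 := qnum_neq0 (ltn0Sn (n - k.+1)).
by field; rewrite !qfact_neq0 k_neq0 d_neq0.
Qed.

Variable m : int.

Definition qexponent (k : nat) : int := 'C(k.+1, 2)%:Z + m * 'C(k, 2)%:Z.

Lemma qexponent_shift k :
  qexponent k.+1 = 1 + (m + 1) * k%:Z + qexponent k.
Proof. by rewrite /qexponent !binS !bin1 !bin0 !PoszD; ring. Qed.

Definition Phi_term (n : nat) (x s : K) (k : nat) : K :=
  q ^ qexponent k * qbinom q (n - 1 - k) k * s ^+ k * x ^+ (n - 1 - 2 * k).

Lemma Phi_widen n N x s : ((n.+1)./2 <= N)%N ->
  Phi n x s m q = \sum_(0 <= k < N | (k.*2 < n)%N) Phi_term n x s k.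
Proof.
move=> le_nN; rewrite /Phi (big_nat_widen _ _ N) //.
by apply: eq_bigl => k /=; lia.
Qed.

Lemma Phi_term0 n x s : Phi_term n x s 0 = x ^+ (n - 1).
Proof.
by rewrite /Phi_term /qexponent !bin0n mulr0 addr0 expr0z qbinom0 !mul1r !subn0.
Qed.

Hypothesis q_neq0 : q != 0.

Lemma Phi_term_rec n x s k : (k.*2 < n)%N ->
  Phi_term n.+2 x s k.+1 =
    x * (if (k.+1.*2 < n.+1)%N then Phi_term n.+1 x (q * s) k.+1 else 0)
    + q * s * Phi_term n x (q ^ (m + 1) * s) k.
Proof.
move=> lt_kn; rewrite /Phi_term.
have -> : (n.+2 - 1 - k.+1 = (n - 1 - k).+1)%N by lia.
have -> : (n.+1 - 1 - k.+1 = n - 1 - k)%N by lia.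
have -> : (n.+2 - 1 - 2 * k.+1 = n - 1 - 2 * k)%N by lia.
have -> : (k.+1.*2 < n.+1)%N = (k < n - 1 - k)%N by lia.
rewrite qbinom_pascal; last by lia.
have qE : q ^ qexponent k.+1 = q * (q ^ (m + 1)) ^+ k * q ^ qexponent k.
  by rewrite exprnP exprz_exp qexponent_shift 2?expfzDr ?expr1z.
rewrite qE !exprMn; case: ifP => lt_k; last by rewrite exprS; ring.
have -> : (n - 1 - 2 * k = (n.+1 - 1 - 2 * k.+1).+1)%N by lia.
by rewrite [x ^+ _.+1]exprS [s ^+ k.+1]exprS; ring.
Qed.

Lemma Phi_rec n x s :
  Phi n.+2 x s m q =
    x * Phi n.+1 x (q * s) m q + q * s * Phi n x (q ^ (m + 1) * s) m q.
Proof.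
rewrite (@Phi_widen n.+2 n.+2) ?(@Phi_widen n.+1 n.+2) ?(@Phi_widen n n.+1);
  [|lia..].
rewrite !(big_mkcond (fun k => (k.*2 < _)%N)) /=.
rewrite [LHS]big_nat_recl // [in X in x * X]big_nat_recl //= !Phi_term0.
rewrite mulrDr -addrA !subn1 -exprS; congr (_ + _).
rewrite !mulr_sumr -big_split /=; apply: eq_bigr => k _.
have -> : (k.+1.*2 < n.+2)%N = (k.*2 < n)%N by lia.
case: ifP => lt_kn; first exact: Phi_term_rec.
by rewrite ifF ?mulr0 ?addr0 //; lia.
Qed.

Lemma Phi0 x s : Phi 0 x s m q = 0.
Proof. by rewrite /Phi big_geq. Qed.

Lemma Phi1 x s : Phi 1 x s m q = 1.
Proof. by rewrite (@Phi_widen 1 1) // big_mkcond big_nat1 Phi_term0 expr0. Qed.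

End QRecurrence.

Lemma q_neq0 (F : fieldType) : q_ F != 0.
Proof.
rewrite /q_ /indet tofrac_eq0.
apply/eqP => /(congr1 (meval (fun=> 1))) /eqP.
by rewrite mevalXU rmorph0 oner_eq0.
Qed.

(** Evaluating all three indeterminates at [0] would turn [q ^+ n = 1] into
    [0 = 1]. *)
Lemma q_expn_neq1 (F : fieldType) n : (0 < n)%N -> q_ F ^+ n != 1.
Proof.
move=> n_gt0; rewrite /q_ /indet -tofracXn -tofrac1 tofrac_eq.
apply/eqP => /(congr1 (meval (fun=> 0))); rewrite rmorphXn rmorph1 /= mevalXU.
by rewrite expr0n gtn_eqF // => /eqP; rewrite eq_sym oner_eq0.
Qed.

Theorem mainTheorem2 (F : fieldType) (m : int) :
  let q := q_ F in
  let x := x_ F in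
  let s := s_ F in
  [/\ forall n : nat, (2 <= n)%N ->
        Phi n x s m q
          = x * Phi (n - 1) x (q * s) m q
            + q * s * Phi (n - 2) x (q ^ (m + 1) * s) m q,
      Phi 0 x s m q = 0
    & Phi 1 x s m q = 1].
Proof.
move=> q x s; split; [|exact: Phi0|by apply: Phi1; exact: q_expn_neq1].
case=> [|[|n]] // _; rewrite subn1 subn2 /=.
by apply: Phi_rec; [exact: q_expn_neq1|exact: q_neq0].
Qed.
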